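(* Let $\Lambda$ be a finite dimensional algebra over a field $K$, and let $\mathcal F_\infty$ be the class of $\Lambda$-modules (up to isomorphism) of the form $DM$, where $M$ is a finitely generated $\Lambda^{\mathrm{op}}$-module with $k\text{-}\operatorname{ddell}M<\infty$ for all integers $k\ge1$. If $0\to A\to B\to C\to0$ is a short exact sequence of finitely generated $\Lambda$-modules and two of the modules $A,B,C$ are in $\mathcal F_\infty$, then so is the third.
   Context: $D=\mathrm{Hom}_K(-,K)$ is the standard duality between finitely generated right $\Lambda^{\mathrm{op}}$-modules and finitely generated right $\Lambda$-modules. For a finite dimensional algebra $\Gamma$ (here $\Gamma=\Lambda^{\mathrm{op}}$), $\mathrm{mod}\,\Gamma$ is the category of finitely generated right $\Gamma$-modules. $\mathbb N$ is the set of nonnegative integers; the infimum of the empty set is $+\infty$. $\Omega M$ is the kernel of a projective cover of $M$, $\Omega^0M=M$, $\Omega^{n+1}M=\Omega(\Omega^nM)$. ''$U$ is a direct summand of $V$ up to projective summands'' means that $U$ is isomorphic to a direct summand of $V\oplus P$ for some projective $P$. For an integer $j\ge1$, $j\text{-}\operatorname{dell}M$ is the infimum of all $n\in\mathbb N$ such that $\Omega^nM$ is a direct summand of $\Omega^{n+j}N$ up to projective summands for some $N\in\mathrm{mod}\,\Gamma$. $k\text{-}\operatorname{ddell}M$ is the infimum of all $m\in\mathbb N$ for which there exist $0\le n\le m$ and an exact sequence $0\to C_n\to\cdots\to C_1\to C_0\to M\to0$ in $\mathrm{mod}\,\Gamma$ with $(i+k)\text{-}\operatorname{dell}C_i\le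 m-i$ for $i=0,\dots,n$. *)

(* Defs.v *)
From HB Require Import structures.
From mathcomp Require Import all_boot all_order all_algebra all_field.
From mathcomp Require Import boolp functions.

Set Implicit Arguments.
Unset Strict Implicit.
Unset Printing Implicit Defensive.

Import GRing.Theory.
Local Open Scope ring_scope.

(** * Conventions on sides

  MathComp's [lmodType R] is the type of left R-modules, and [R^c] is the
  opposite ring.  For an algebra L we therefore use
    - [lmodType L]   for right modules over the opposite algebra of L,
    - [lmodType L^c] for right L-modules.
  The ring R below is arbitrary; the syzygy-theoretic notions of mod Gamma,
  for Gamma the opposite algebra of L, are obtained with R := L. *)

(** * The extended natural numbers: [None] is +oo *)

Definition enat := option nat.

Definition enat_inf (P : nat -> Prop) : enat :=
  if pselect (exists n, `[< P n >]) is left ex then Some (ex_minn ex) else None.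

Definition enat_le (x : enat) (m : nat) : bool :=
  if x is Some n then (n <= m)%N else false.

Definition enat_finite (x : enat) : bool := isSome x.

Lemma enat_inf_le (P : nat -> Prop) (m : nat) :
  enat_le (enat_inf P) m <-> exists2 n, (n <= m)%N & P n.
Proof.
rewrite /enat_inf; case: pselect => [ex|nex] /=; last first.
  by split=> // -[n _ Pn]; case: nex; exists n; apply/asboolP.
case: ex_minnP => n /asboolP Pn n_min; split=> [le_nm|[p le_pm Pp]].
  by exists n.
by apply: leq_trans le_pm; apply: n_min; apply/asboolP.
Qed.

Lemma enat_inf_finite (P : nat -> Prop) :
  enat_finite (enat_inf P) <-> exists n, P n.
Proof.
rewrite /enat_inf; case: pselect => [ex|nex] /=.
  by split=> // _; case: ex => n /asboolP Pn; exists n.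
by split=> // -[n Pn]; case: nex; exists n; apply/asboolP.
Qed.

(** * Finitely generated modules *)

Definition finitely_generated (R : pzRingType) (M : lmodType R) : Prop :=
  exists (n : nat) (e : 'I_n -> M),
    forall x : M, exists c : 'I_n -> R, x = \sum_(i < n) c i *: e i.

Record fgmod (R : pzRingType) : Type := Fgmod {
  fgmod_sort :> lmodType R;
  fgmod_fg : finitely_generated fgmod_sort
}.

(** * Exactness, isomorphisms, projective covers *)

Section Modules.
Variable R : pzRingType.

Definition surj (U V : lmodType R) (f : {linear U -> V}) : Prop :=
  forall y, exists x, f x = y.

Definition exact_at (U V W : lmodType R)
    (f : {linear U -> V}) (g : {linear V -> W}) : Prop :=
  forall y, g y = 0 <-> exists x, f x = y.

Definition short_exact (U V W : lmodType R)
    (f : {linear U -> V}) (g : {linear V -> W}) : Prop :=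
  [/\ injective f, exact_at f g & surj g].

Definition iso (U V : lmodType R) : Prop :=
  exists f : {linear U -> V}, bijective f.

Definition projective (P : lmodType R) : Prop :=
  forall (U V : lmodType R) (g : {linear U -> V}) (f : {linear P -> V}),
    surj g -> exists h : {linear P -> U}, forall x, g (h x) = f x.

Definition superfluous (P : lmodType R) (S : P -> Prop) : Prop :=
  forall N : {pred P}, submod_closed N ->
    (forall x, exists y z, [/\ y \in N, S z & x = y + z]) ->
    forall x, x \in N.

Definition projective_cover (P M : lmodType R) (p : {linear P -> M}) : Prop :=
  [/\ projective P, surj p & superfluous (fun x => p x = 0)].

End Modules.

(** * Syzygies and delooping levels *)

Section DeloopingLevels.
Variable R : pzRingType.
Implicit Types (M N S T U V : fgmod R).

(* Syzygies are only defined up to isomorphism, so the equations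
   "S = Omega M" and "S = Omega^n M" are rendered as relations. *)
Definition is_syzygy M S : Prop :=
  exists (P : fgmod R) (p : {linear P -> M}) (i : {linear S -> P}),
    [/\ projective_cover p, injective i & exact_at i p].

Fixpoint is_nsyzygy (n : nat) M S : Prop :=
  if n is n'.+1 then exists2 T, is_nsyzygy n' M T & is_syzygy T S
  else iso M S.

Definition stable_summand U V : Prop :=
  exists2 P : fgmod R, projective P &
  exists W : fgmod R, iso (U * W)%type (V * P)%type.

Definition dell (j : nat) M : enat :=
  enat_inf (fun n => exists N S T,
    [/\ is_nsyzygy n M S, is_nsyzygy (n + j) N T & stable_summand S T]).

(* An exact sequence 0 -> C_n -> ... -> C_1 -> C_0 -> M -> 0, extended by
   C_i = 0 for i > n; the map d i goes from C_(i+1) to C_i. *)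
Definition exact_resolution (n : nat) M (C : nat -> fgmod R)
    (d : forall i, {linear C i.+1 -> C i}) (eps : {linear C 0%N -> M}) : Prop :=
  [/\ surj eps,
      exact_at (d 0%N) eps,
      forall i, exact_at (d i.+1) (d i)
    & forall i, (n < i)%N -> forall x : C i, x = 0].

Definition ddell (k : nat) M : enat :=
  enat_inf (fun m => exists n (C : nat -> fgmod R)
    (d : forall i, {linear C i.+1 -> C i}) (eps : {linear C 0%N -> M}),
    [/\ (n <= m)%N, exact_resolution n d eps
      & forall i, (i <= n)%N -> enat_le (dell (i + k) (C i)) (m - i)]).

End DeloopingLevels.

(** * The duality D = Hom_K(-, K) *)

Section Duality.
Variables (K : fieldType) (L : falgType K).

(* K acts on an L-module through the structure map c |-> c%:A of L. *)
Definition Klinear (M : lmodType L) (f : M -> K) : Prop :=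
  forall (c : K) (x y : M), f (c%:A *: x + y) = c * f x + f y.

Record Kdual (M : lmodType L) : Type := Dual {
  dual_fun :> M -> K;
  dual_funP : `[< Klinear dual_fun >]
}.

Section DualModule.
Variable M : lmodType L.
Implicit Types f g : Kdual M.

HB.instance Definition _ := [isSub for @dual_fun M].
HB.instance Definition _ := [Choice of Kdual M by <:].

Lemma dualP f g : (forall x, f x = g x) <-> f = g.
Proof. by split=> [fg|->//]; apply/val_inj/funext. Qed.

Lemma dual_Klinear f : Klinear f.
Proof. exact: asboolW (dual_funP f). Qed.

Lemma dual0_subproof : `[< Klinear (fun _ : M => 0) >].
Proof. by apply/asboolP=> c x y; rewrite mulr0 addr0. Qed.

Lemma dualN_subproof f : `[< Klinear (fun x => - f x) >].
Proof. by apply/asboolP=> c x y; rewrite dual_Klinear opprD mulrN. Qed.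

Lemma dualD_subproof f g : `[< Klinear (fun x => f x + g x) >].
Proof. by apply/asboolP=> c x y; rewrite !dual_Klinear mulrDr addrACA. Qed.

Lemma dualZ_subproof (a : L) f : `[< Klinear (fun x => f (a *: x)) >].
Proof.
apply/asboolP=> c x y.
by rewrite scalerDr scalerA -scalerAr mulr1 -[a in c *: a]mul1r scalerAl
           -scalerA dual_Klinear.
Qed.

Definition dual0 := Dual dual0_subproof.
Definition dualN f := Dual (dualN_subproof f).
Definition dualD f g := Dual (dualD_subproof f g).
Definition dualZ (a : L^c) f := Dual (dualZ_subproof a f).

Lemma dualDA : associative dualD.
Proof. by move=> f g h; apply/dualP=> x /=; rewrite addrA. Qed.

Lemma dualDC : commutative dualD.
Proof. by move=> f g; apply/dualP=> x /=; rewrite addrC. Qed.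

Lemma dual0D : left_id dual0 dualD.
Proof. by move=> f; apply/dualP=> x /=; rewrite add0r. Qed.

Lemma dualND : left_inverse dual0 dualN dualD.
Proof. by move=> f; apply/dualP=> x /=; rewrite addNr. Qed.

HB.instance Definition _ :=
  GRing.isZmodule.Build (Kdual M) dualDA dualDC dual0D dualND.

Lemma dualZA (a b : L^c) f : dualZ a (dualZ b f) = dualZ (a * b) f.
Proof. by apply/dualP=> x /=; rewrite scalerA. Qed.

Lemma dual1Z : left_id 1 dualZ.
Proof. by move=> f; apply/dualP=> x /=; rewrite scale1r. Qed.

Lemma dualZDr : right_distributive dualZ +%R.
Proof. by move=> a f g; apply/dualP. Qed.

Lemma dualZDl f : {morph dualZ^~ f : a b / a + b}.
Proof.
move=> a b; apply/dualP=> x /=; rewrite scalerDl.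
by have := dual_Klinear f 1 ((a : L) *: x) ((b : L) *: x);
  rewrite mul1r !scale1r.
Qed.

HB.instance Definition _ :=
  GRing.Zmodule_isLmodule.Build L^c (Kdual M) dualZA dual1Z dualZDr dualZDl.

End DualModule.

Definition in_Finfty (X : fgmod L^c) : Prop :=
  exists2 M : fgmod L,
    forall k : nat, (1 <= k)%N -> enat_finite (ddell k M) & iso X (Kdual M).

End Duality.

(* Main.v *)
Require Import Defs.
From HB Require Import structures.
From mathcomp Require Import all_boot all_order all_algebra all_field.
From mathcomp Require Import boolp.

(** Since D is an exact duality, the claim is the two-out-of-three property for
  the left L-modules M all of whose k-ddell are finite.  Let D^k be the class
  of modules with finite k-dell, and F^k the class of modules having a finite
  resolution with i-th term in D^(k+i); then k-ddell M is finite iff M lies in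
  F^k.  Schanuel's lemma shows that D^k contains the projectives, is closed
  under stable retracts, and that Omega D^k is contained in D^(k+1).
  - Extensions: if C is in D^k, P -> C is onto with P projective, and A_0 -> A
    starts a resolution of A, then A_0 + P -> B is onto and its kernel is an
    extension of Omega C by the kernel of A_0 -> A; induct on the length of the
    resolution of A.  For general C, B is the cokernel of C_1 in the pullback
    of B and C_0 over C, where C_1 = ker (C_0 -> C) has a shorter resolution:
    use the next case, which needs extensions only by its first term.
  - Cokernels: if A is in F^(k+1) and B in F^k, the kernel of B_0 -> B -> C is
    an extension of A by the kernel of B_0 -> B, hence in F^(k+1), so that C is
    in F^k.
  - Kernels: with P -> C_0 -> C onto, P projective, the kernel W is an extension
    of modules in F^(k+1); the pullback of B and P over C is A + P and an
    extension of B by W, and A is the cokernel of P -> A + P. *)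

Set Implicit Arguments.
Unset Strict Implicit.
Unset Printing Implicit Defensive.

Import GRing.Theory.
Local Open Scope ring_scope.

Section LinearMaps.
Variable R : pzRingType.
Implicit Types M N U V W : lmodType R.

Lemma linear_ex U V (f : U -> V) :
  linear f -> exists g : {linear U -> V}, g =1 f.
Proof.
move=> lf; pose mf := GRing.isLinear.Build R U V *:%R f lf.
by exists (HB.pack_for {linear U -> V} f mf).
Qed.

Lemma bij_inv_linear U V (f : {linear U -> V}) :
  injective f -> surj f ->
  exists g : {linear V -> U}, cancel f g /\ cancel g f.
Proof.
move=> finj /choice[g fg].
have gf : cancel f g by move=> x; apply: finj; rewrite fg.
have [h hg] := linear_ex (can2_linear gf fg).
by exists h; split=> x; rewrite hg.
Qed.

Lemma iso_of_bij U V (f : {linear U -> V}) : injective f -> surj f -> iso U V.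
Proof. by move=> fi fs; have [g [fK gK]] := bij_inv_linear fi fs; exists f, g. Qed.

Lemma isoP U V : iso U V ->
  exists (f : {linear U -> V}) (g : {linear V -> U}), cancel f g /\ cancel g f.
Proof.
case=> f [g fK gK]; exists f; apply: bij_inv_linear; first exact: can_inj fK.
by move=> y; exists (g y).
Qed.

Lemma iso_refl U : iso U U.
Proof. by exists idfun, idfun. Qed.

Lemma iso_sym U V : iso U V -> iso V U.
Proof. by case/isoP=> f [g [fK gK]]; exists g, f. Qed.

Lemma factor_injective M N U (i : {linear N -> M}) (g : {linear U -> M}) :
  injective i -> (forall x, exists y, i y = g x) ->
  exists h : {linear U -> N}, forall x, i (h x) = g x.
Proof.
move=> iinj /choice[h ih].
suff /linear_ex[k kh] : linear h by exists k => x; rewrite kh.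
by move=> a x y; apply: iinj; rewrite linearP !ih linearP.
Qed.

Lemma linear_pair U V W (f : {linear U -> V}) (g : {linear U -> W}) :
  exists h : {linear U -> (V * W)%type}, forall x, h x = (f x, g x).
Proof.
by apply: linear_ex => a x y; rewrite !linearP.
Qed.

Lemma linear_copair U V W (f : {linear U -> W}) (g : {linear V -> W}) :
  exists h : {linear (U * V)%type -> W}, forall x, h x = f x.1 + g x.2.
Proof.
apply: linear_ex => a x y /=.
by rewrite !linearP scalerDr addrACA.
Qed.

Lemma linear_fst U V : exists f : {linear (U * V)%type -> U}, forall x, f x = x.1.
Proof. by apply: linear_ex. Qed.

Lemma linear_snd U V : exists f : {linear (U * V)%type -> V}, forall x, f x = x.2.
Proof. by apply: linear_ex. Qed.

Lemma linear_inl U V : exists f : {linear U -> (U * V)%type}, forall x, f x = (x, 0).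
Proof.
apply: linear_ex => a x y; have e : a *: 0 + 0 = 0 :> V by rewrite scaler0 addr0.
by rewrite -[in LHS]e.
Qed.

Lemma linear_inr U V : exists f : {linear V -> (U * V)%type}, forall x, f x = (0, x).
Proof.
apply: linear_ex => a x y; have e : a *: 0 + 0 = 0 :> U by rewrite scaler0 addr0.
by rewrite -[in LHS]e.
Qed.

Lemma pair_split U V (x : U) (y : V) : (x, 0) + (0, y) = (x, y) :> U * V.
Proof.
have e1 : x + 0 = x by rewrite addr0.
have e2 : 0 + y = y by rewrite add0r.
by rewrite -[in RHS]e1 -[in RHS]e2.
Qed.

Lemma linear_comb U V (f : {linear U -> V}) n (c : 'I_n -> R) (e : 'I_n -> U) :
  f (\sum_i c i *: e i) = \sum_i c i *: f (e i).
Proof. by rewrite linear_sum; apply: eq_bigr => i _; rewrite linearZ. Qed.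

End LinearMaps.

Section Submodule.
Variables (R : pzRingType) (M : lmodType R).

Record submodule := Submodule {
  submod_mem :> M -> Prop;
  submod_memP : submod_mem 0 /\
    forall (a : R) x y, submod_mem x -> submod_mem y -> submod_mem (a *: x + y)
}.

Variable S : submodule.

Definition submod_pred : {pred M} := fun x => `[< S x >].

Lemma submod_pred_closed : submod_closed submod_pred.
Proof.
case: (submod_memP S) => S0 SP; split=> [|a x y /asboolP Sx /asboolP Sy].
  exact/asboolP.
by apply/asboolP/SP.
Qed.

Inductive submod_type : Type := SubmodElt x of x \in submod_pred.
Definition submod_val u := let: SubmodElt x _ := u in x.
HB.instance Definition _ := [isSub of submod_type for submod_val].
HB.instance Definition _ := [Choice of submod_type by <:].
HB.instance Definition _ :=
  GRing.isSubmodClosed.Build R M submod_pred submod_pred_closed.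
HB.instance Definition _ := [SubChoice_isSubLmodule of submod_type by <:].

End Submodule.

Lemma submodule_ex (R : pzRingType) (M : lmodType R) (S : M -> Prop) :
  S 0 -> (forall (a : R) x y, S x -> S y -> S (a *: x + y)) ->
  exists (N : lmodType R) (i : {linear N -> M}),
    injective i /\ forall y, S y <-> exists x, i x = y.
Proof.
move=> S0 SP; pose T := Submodule (conj S0 SP).
exists (submod_type T), (\val : {linear submod_type T -> M}).
split; first exact: val_inj.
move=> y; split=> [Sy|[[x Sx] <-]]; last exact/asboolP.
by exists (SubmodElt (introT (asboolP (T y)) Sy)).
Qed.

Section FreeModules.
Variable R : pzRingType.

Lemma free_projective n : projective 'rV[R]_n.
Proof.
move=> U V g f gs.
have [u gu] := choice (fun i : 'I_n => gs (f 'e_i)).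
have [|h hE] := @linear_ex R 'rV[R]_n U (fun v => \sum_i v 0 i *: u i).
  move=> a x y; rewrite scaler_sumr -big_split /=; apply: eq_bigr => i _.
  by rewrite !mxE scalerDl scalerA.
exists h => x; rewrite hE [in RHS](row_sum_delta x) !linear_sum.
by apply: eq_bigr => i _; rewrite !linearZ /= gu.
Qed.

Lemma free_fg n : finitely_generated 'rV[R]_n.
Proof.
exists n, (fun i => 'e_i) => x; exists (fun i => x 0 i); exact: row_sum_delta.
Qed.

Lemma quotient_fg (M N : lmodType R) (p : {linear M -> N}) :
  surj p -> finitely_generated M -> finitely_generated N.
Proof.
move=> ps [n [e eP]]; exists n, (p \o e) => y; have [x <-] := ps y.
have [c ->] := eP x; exists c; exact: linear_comb.
Qed.

Lemma prod_fg (M N : lmodType R) :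
  finitely_generated M -> finitely_generated N ->
  finitely_generated (M * N)%type.
Proof.
move=> [m [e eP]] [n [d dP]].
exists (m + n)%N, (fun k =>
  match split k with inl i => (e i, 0) | inr j => (0, d j) end).
move=> [x y]; have [a xE] := eP x; have [b yE] := dP y.
exists (fun k => match split k with inl i => a i | inr j => b j end).
rewrite big_split_ord /=.
rewrite (eq_bigr (fun i => (a i *: e i, 0 : N))); last first.
  move=> i _; rewrite (unsplitK (inl i)).
  by congr (_, _); rewrite scaler0.
rewrite (eq_bigr (fun i => (0 : M, b i *: d i))); last first.
  move=> i _; rewrite (unsplitK (inr i)).
  by congr (_, _); rewrite scaler0.
have [p pE] := linear_fst M N; have [q qE] := linear_snd M N.
rewrite [RHS]surjective_pairing.
congr (_, _); rewrite -?pE -?qE linearD !linear_sum.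
  rewrite [X in _ + X]big1 ?addr0 => [|i _]; last by rewrite pE.
  by rewrite xE; apply: eq_bigr => i _; rewrite pE.
rewrite big1 ?add0r => [|i _]; last by rewrite qE.
by rewrite yE; apply: eq_bigr => i _; rewrite qE.
Qed.

Lemma free_cover (M : fgmod R) :
  exists (P : fgmod R) (p : {linear P -> M}), projective P /\ surj p.
Proof.
have [n [e eP]] := fgmod_fg M.
have [|p pE] := @linear_ex R 'rV[R]_n M (fun v => \sum_i v 0 i *: e i).
  move=> a x y; rewrite scaler_sumr -big_split /=; apply: eq_bigr => i _.
  by rewrite !mxE scalerDl scalerA.
exists (Fgmod (free_fg n)), p; split; first exact: free_projective.
move=> y; have [c ->] := eP y; exists (\row_i c i); rewrite pE.
by apply: eq_bigr => i _; rewrite mxE.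
Qed.

End FreeModules.
Lemma least_ex (P : nat -> Prop) :
  (exists n, P n) -> exists2 n, P n & forall m, (m < n)%N -> ~ P m.
Proof.
move=> [n Pn]; have ex : exists n, `[< P n >] by exists n; apply/asboolP.
case: (ex_minnP ex) => m /asboolP Pm m_min; exists m => // p.
by rewrite ltnNge => /negP pm Pp; apply: pm; apply/m_min/asboolP.
Qed.

(* [s] makes every R-module a K-vector space.  R is not taken to be a [falgType]:
   for R = L^c, the base ring of that structure on L^c is not recognized as L^c. *)
Section FiniteDimension.
Variables (K : fieldType) (R : pzRingType) (s : {rmorphism K -> R}).

Section Spans.
Variable M : lmodType R.
Implicit Types (U : M -> Prop).

Definition subspace U := U 0 /\ forall c x y, U x -> U y -> U (s c *: x + y).

Definition spans_mod U n (e : 'I_n -> M) :=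
  forall x, exists c : 'I_n -> K, U (x - \sum_i s (c i) *: e i).

Lemma subspaceB U x y : subspace U -> U x -> U y -> U (x - y).
Proof.
case=> U0 UP Ux Uy; rewrite addrC -scaleN1r.
by have := UP (-1) y x Uy Ux; rewrite rmorphN1.
Qed.

Lemma minimal_spans_indep U n (e : 'I_n -> M) :
  subspace U -> spans_mod U e ->
  (forall m, (m < n)%N -> forall e' : 'I_m -> M, ~ spans_mod U e') ->
  forall c, U (\sum_i s (c i) *: e i) -> forall i, c i = 0.
Proof.
case: n e => [|n] e sU eP n_min c Uc i; first by case: i.
apply/eqP/negPn/negP => ci0.
case: (n_min n (leqnn _) (fun j => e (lift i j))) => x; have [d Ud] := eP x.
pose t := d i / c i.
exists (fun j => d (lift i j) - t * c (lift i j)).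
have := sU.2 t _ _ Uc Ud; congr U; rewrite addrCA; congr (_ + _).
rewrite scaler_sumr -sumrB -sumrN (bigD1_ord i) //=.
rewrite scalerA -rmorphM divfK // subrr add0r; apply: eq_bigr => j _.
by rewrite scalerA -rmorphM -scalerBl -rmorphB -scaleNr -rmorphN opprB.
Qed.

Lemma frame_mod U : subspace U -> (exists n (e : 'I_n -> M), spans_mod U e) ->
  exists n (e : 'I_n -> M) (d : 'I_n -> M -> K),
    [/\ forall i c x y, d i (s c *: x + y) = c * d i x + d i y,
        forall i u, U u -> d i u = 0
      & forall x, U (x - \sum_i s (d i x) *: e i)].
Proof.
move=> sU /least_ex[n [e eP] n_min].
have indep : forall c, U (\sum_i s (c i) *: e i) -> forall i, c i = 0.
  by apply: minimal_spans_indep => // m mn e' He'; apply: (n_min m mn); exists e'.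
have [d dP] := choice eP.
have uniq x y c : U (x - y) -> U (y - \sum_i s (c i) *: e i) ->
    forall i, d x i = c i.
  move=> Uxy Uy i; apply/eqP; rewrite -subr_eq0; apply/eqP.
  apply: (indep (fun i => d x i - c i)).
  have : U (x - \sum_i s (c i) *: e i).
    by have := sU.2 1 _ _ Uxy Uy; rewrite rmorph1 scale1r addrA subrK.
  move=> /subspaceB/(_ (dP x))-/(_ sU); congr U.
  rewrite opprB addrC addrA subrK -sumrB; apply: eq_bigr => j _.
  by rewrite rmorphB scalerBl.
exists n, e, (fun i x => d x i); split => //.
- move=> i c x y; apply: (uniq _ (s c *: x + y) (fun i => c * d x i + d y i)).
    by rewrite subrr; exact: sU.1.
  have := sU.2 c _ _ (dP x) (dP y); congr U.
  rewrite scalerBr addrACA; congr (_ + _).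
  rewrite scaler_sumr -!sumrN -big_split; apply: eq_bigr => j _ /=.
  by rewrite rmorphD rmorphM scalerDl scalerA opprD.
- move=> i u Uu; apply: (uniq _ 0 (fun=> 0)); rewrite ?subr0 // big1 ?subr0.
    exact: sU.1.
  by move=> j _; rewrite rmorph0 scale0r.
Qed.

End Spans.

Lemma subspace_eq0 (M : lmodType R) : subspace (fun x : M => x = 0).
Proof. by split=> // c x y -> ->; rewrite scaler0 addr0. Qed.

Definition scalar_linear (M N : lmodType R) (r : M -> N) :=
  forall c x y, r (s c *: x + y) = s c *: r x + r y.

Lemma linear_scalar_linear (M N : lmodType R) (f : {linear M -> N}) :
  scalar_linear f.
Proof. by move=> c x y; rewrite linearP. Qed.

Lemma scalar_linear0 (M N : lmodType R) (r : M -> N) : scalar_linear r -> r 0 = 0.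
Proof.
move=> /(_ 1 0 0); rewrite rmorph1 !scale1r addr0 => /eqP.
by rewrite -[X in X == _]addr0 (inj_eq (addrI _)) => /eqP.
Qed.

Lemma scalar_linear_comb (M N : lmodType R) (r : M -> N) n
    (c : 'I_n -> K) (e : 'I_n -> M) :
  scalar_linear r -> r (\sum_i s (c i) *: e i) = \sum_i s (c i) *: r (e i).
Proof.
move=> rlin; elim/big_rec2: _ => [|i x y _ <-]; last by rewrite rlin.
exact: scalar_linear0.
Qed.

Definition spanned n (M : lmodType R) :=
  exists e : 'I_n -> M, spans_mod (fun x => x = 0) e.

Lemma spannedP n (M : lmodType R) :
  spanned n M <->
  exists e : 'I_n -> M, forall x, exists c : 'I_n -> K, x = \sum_i s (c i) *: e i.
Proof.
split=> -[e eP]; exists e => x; have [c xE] := eP x; exists c.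
  by apply/eqP; rewrite -subr_eq0; apply/eqP.
by apply/eqP; rewrite subr_eq0; apply/eqP.
Qed.

Lemma surj_minimal_inj n (M N : lmodType R) (p : M -> N) :
  scalar_linear p -> (forall y, exists x, p x = y) -> spanned n M ->
  (forall m, (m < n)%N -> ~ spanned m N) -> injective p.
Proof.
move=> plin ps /spannedP[e eP] n_min.
have p_ker z : p z = 0 -> z = 0.
  have [c zE] := eP z => pz0.
  rewrite zE big1 // => i _.
  suff -> : c i = 0 by rewrite rmorph0 scale0r.
  apply: (@minimal_spans_indep N (fun y => y = 0) n (p \o e)).
  - exact: subspace_eq0.
  - move=> y; have [x <-] := ps y; have [b ->] := eP x; exists b.
    by rewrite scalar_linear_comb // subrr.
  - by move=> m mn e' He'; apply: (n_min m mn); exists e'.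
  - by rewrite -[RHS]pz0 zE scalar_linear_comb.
move=> x y pxy; apply/eqP; rewrite -subr_eq0; apply/eqP/p_ker.
by rewrite addrC -scaleN1r -(rmorphN1 s) plin rmorphN1 scaleN1r pxy addNr.
Qed.

Hypothesis R_finite :
  exists n (b : 'I_n -> R), forall a, exists c : 'I_n -> K, a = \sum_i s (c i) * b i.

Lemma spanned_fg n (M : lmodType R) : spanned n M -> finitely_generated M.
Proof.
move=> [e eP]; exists n, e => x; have [c /eqP] := eP x.
by rewrite subr_eq0 => /eqP xE; exists (fun i => s (c i)).
Qed.

Lemma fg_spanned (M : lmodType R) : finitely_generated M -> exists n, spanned n M.
Proof.
move=> [n [e eP]]; have [m [b bP]] := R_finite.
pose I := ('I_n * 'I_m)%type.
exists #|{: I}|, (fun k : 'I_#|{: I}| => b (enum_val k).2 *: e (enum_val k).1) => x.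
have [a ->] := eP x; have [c cE] := choice (fun i => bP (a i)).
exists (fun k => c (enum_val k).1 (enum_val k).2); apply/eqP; rewrite subr_eq0.
apply/eqP; rewrite -(big_enum_val (A := {: I})
  (fun p => s (c p.1 p.2) *: (b p.2 *: e p.1))).
rewrite /= -(pair_bigA _ (fun i j => s (c i j) *: (b j *: e i))) /=.
apply: eq_bigr => i _; rewrite {1}cE scaler_suml.
by apply: eq_bigr => j _; rewrite scalerA.
Qed.

Lemma fg_frame_mod (M : lmodType R) (U : M -> Prop) :
  finitely_generated M -> subspace U ->
  exists n (e : 'I_n -> M) (d : 'I_n -> M -> K),
    [/\ forall i c x y, d i (s c *: x + y) = c * d i x + d i y,
        forall i u, U u -> d i u = 0
      & forall x, U (x - \sum_i s (d i x) *: e i)].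
Proof.
move=> /fg_spanned[n [e eP]] sU; apply: frame_mod => //.
exists n, e => x; have [c cE] := eP x; exists c; rewrite cE; exact: sU.1.
Qed.

Lemma fg_retraction (M N : lmodType R) (i : {linear N -> M}) :
  finitely_generated M -> injective i ->
  exists r : M -> N, scalar_linear r /\ cancel i r.
Proof.
move=> fgM iinj; pose U x := exists y, i y = x.
have sU : subspace U.
  split; first by exists 0; rewrite linear0.
  by move=> c _ _ [x <-] [y <-]; exists (s c *: x + y); rewrite linearP.
have [n [e [d [dlin dU dP]]]] := fg_frame_mod fgM sU.
have [r rP] := choice dP; exists r; split.
  move=> c x y; apply: iinj; rewrite linearP !rP scalerBr addrACA.
  congr (_ + _); rewrite scaler_sumr -!sumrN -big_split; apply: eq_bigr => j _ /=.
  by rewrite dlin rmorphD rmorphM scalerDl scalerA opprD.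
move=> x; apply: iinj; rewrite rP big1 ?subr0 // => j _.
by rewrite dU ?rmorph0 ?scale0r //; exists x.
Qed.

Lemma sub_fg (M N : lmodType R) (i : {linear N -> M}) :
  injective i -> finitely_generated M -> finitely_generated N.
Proof.
move=> iinj fgM; have [r [rlin rK]] := fg_retraction fgM iinj.
have [n [e eP]] := fg_spanned fgM.
apply: (@spanned_fg n); exists (r \o e) => x; have [c /eqP] := eP (i x).
rewrite subr_eq0 => /eqP ixE; exists c; apply/eqP; rewrite subr_eq0.
by rewrite -{1}(rK x) ixE scalar_linear_comb.
Qed.

Lemma injective_endo_surj (M : lmodType R) (g : {linear M -> M}) :
  finitely_generated M -> injective g -> surj g.
Proof.
move=> fgM ginj; have [r [rlin rK]] := fg_retraction fgM ginj.
have /least_ex[n Mn n_min] := fg_spanned fgM.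
have rinj : injective r.
  by apply: (surj_minimal_inj rlin _ Mn n_min) => y; exists (g y).
by move=> x; exists (r x); apply: rinj.
Qed.

End FiniteDimension.
Lemma projective_retract (R : pzRingType) (P Q : lmodType R)
    (i : {linear Q -> P}) (r : {linear P -> Q}) :
  cancel i r -> projective P -> projective Q.
Proof.
move=> iK projP U V g f gs; have [h hP] := projP _ _ g (f \o r) gs.
by exists (h \o i) => x /=; rewrite hP /= iK.
Qed.

Lemma image_factorization (R : pzRingType) (M N : lmodType R) (h : {linear M -> N}) :
  exists (I : lmodType R) (q : {linear M -> I}) (j : {linear I -> N}),
    [/\ surj q, injective j & forall x, j (q x) = h x].
Proof.
have [||I [j [jinj jP]]] := @submodule_ex R N (fun y => exists x, h x = y).
- by exists 0; rewrite linear0.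
- by move=> a _ _ [x <-] [y <-]; exists (a *: x + y); rewrite linearP.
have [|q qP] := factor_injective (g := h) jinj.
  by move=> x; apply/jP; exists x.
exists I, q, j; split=> // y.
have [x xE] : exists x, h x = j y by apply/jP; exists y.
by exists x; apply: jinj; rewrite qP.
Qed.

(* Take P of minimal dimension.  If N + ker p = P then id lifts to h : P -> N
   with p h = p; for h of minimal rank Fitting's lemma makes im h a summand of
   P which still covers M, so that h is bijective and N = P. *)
Lemma projective_cover_ex (K : fieldType) (R : pzRingType) (s : {rmorphism K -> R}) :
  (exists n (b : 'I_n -> R),
     forall a, exists c : 'I_n -> K, a = \sum_i s (c i) * b i) ->
  forall M : fgmod R, exists (P : fgmod R) (p : {linear P -> M}), projective_cover p.
Proof.
move=> R_finite M.
pose size_of_cover n := exists (P : fgmod R) (p : {linear P -> M}),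
  [/\ projective P, surj p & spanned s n P].
have /least_ex[n [P [p [projP ps Pn]]] n_min] : exists n, size_of_cover n.
  have [P [p [projP ps]]] := free_cover M.
  have [n Pn] := fg_spanned R_finite (fgmod_fg P).
  by exists n, P, p.
exists P, p; split=> // N [N0 NP] Nker.
have [||N' [i [iinj iP]]] := @submodule_ex R P (fun x => x \in N).
- exact: N0.
- by move=> a x y; apply: NP.
have pis : surj (p \o i).
  move=> z; have [x <-] := ps z; have [y [u [/iP[v <-] pu0 ->]]] := Nker x.
  by exists v; rewrite /= linearD pu0 addr0.
pose rank r := exists (I : lmodType R) (q : {linear P -> I}) (j : {linear I -> P}),
  [/\ surj q, injective j, forall x, p (j (q x)) = p x,
      forall y, j y \in N & spanned s r I].
have /least_ex[r [I [q [j [qs jinj pjq jN Ir]]]] r_min] : exists r, rank r.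
  have [h0 h0P] := projP _ _ (p \o i) p pis.
  have [I [q [j [qs jinj jq]]]] := image_factorization (i \o h0).
  have [r Ir] := fg_spanned R_finite (quotient_fg qs (fgmod_fg P)).
  exists r, I, q, j; split=> // [x|y]; first by rewrite jq; exact: h0P.
  by have [x <-] := qs y; rewrite jq; apply: (iP _).2; exists (h0 x).
have fgI := quotient_fg qs (fgmod_fg P).
have ginj : injective (q \o j).
  have [I2 [q2 [j2 [q2s j2inj jq2]]]] := image_factorization (q \o j).
  have q2inj : injective q2.
    apply: (surj_minimal_inj (linear_scalar_linear s q2) q2s Ir) => m mr I2m.
    apply: (r_min m mr); exists I2, (q2 \o q), (j \o j2); split=> //=.
    - by move=> y; have [x <-] := q2s y; have [z <-] := qs x; exists z.
    - exact: inj_comp.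
    - by move=> x; rewrite jq2 /= !pjq.
  by move=> x y; rewrite -!jq2 => /j2inj/q2inj.
have gs : surj (q \o j) := injective_endo_surj R_finite fgI ginj.
have [g' [gK g'K]] := bij_inv_linear ginj gs.
have projI : projective I by apply: (projective_retract (i := j) (r := g' \o q)).
have qinj : injective q.
  apply: (surj_minimal_inj (linear_scalar_linear s q) qs Pn) => m mn Im.
  apply: (n_min m mn); exists (Fgmod fgI), (p \o j); split=> //= z.
  by have [x <-] := ps z; exists (q x); rewrite /= pjq.
have hs : surj (j \o q).
  by apply: (injective_endo_surj R_finite (fgmod_fg P)); apply: inj_comp.
by move=> x; have [y <-] := hs x; exact: jN.
Qed.
Section Syzygies.
Variable R : pzRingType.
Hypothesis submodule_fg : forall (M N : lmodType R) (i : {linear N -> M}),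
  injective i -> finitely_generated M -> finitely_generated N.
Hypothesis projective_covers :
  forall M : fgmod R, exists (P : fgmod R) (p : {linear P -> M}), projective_cover p.
Implicit Types A B C M N P Q S T U V W : fgmod R.

Definition fg_prod M N : fgmod R := Fgmod (prod_fg (fgmod_fg M) (fgmod_fg N)).

Definition fg_zero : fgmod R := Fgmod (free_fg R 0).

Lemma fg_zero_eq0 (x : fg_zero) : x = 0.
Proof. exact: thinmx0. Qed.

Definition ses A B C :=
  exists (f : {linear A -> B}) (g : {linear B -> C}), short_exact f g.

Lemma prod_projective P Q : projective P -> projective Q -> projective (fg_prod P Q).
Proof.
move=> projP projQ U V g f gs.
have [i iE] := linear_inl P Q.
have [j jE] := linear_inr P Q.
have [h hP] := projP _ _ g (f \o i) gs; have [k kP] := projQ _ _ g (f \o j) gs.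
have [l lE] := linear_copair h k; exists l => -[x y].
by rewrite lE linearD hP kP /= -linearD iE jE pair_split.
Qed.

Lemma kernel_ex B C (g : {linear B -> C}) :
  exists A (f : {linear A -> B}), injective f /\ exact_at f g.
Proof.
have [||A [f [finj fP]]] := @submodule_ex R B (fun x => g x = 0).
- exact: linear0.
- by move=> a x y gx gy; rewrite linearP gx gy scaler0 addr0.
by exists (Fgmod (submodule_fg finj (fgmod_fg B))), f.
Qed.

Lemma exact_comp0 A B C (f : {linear A -> B}) (g : {linear B -> C}) x :
  exact_at f g -> g (f x) = 0.
Proof. by move=> fg; apply/fg; exists x. Qed.

Lemma exact_lift A B C U (f : {linear A -> B}) (g : {linear B -> C})
    (h : {linear U -> B}) :
  injective f -> exact_at f g -> (forall x, g (h x) = 0) ->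
  exists k : {linear U -> A}, forall x, f (k x) = h x.
Proof. by move=> finj fg gh0; apply: factor_injective => // x; apply/fg. Qed.

(* U is a retract of V + P: here (i, i') is U -> V + P and (r, r') is V + P -> U. *)
Definition stable_retract U V :=
  exists P (i : {linear U -> V}) (i' : {linear U -> P})
    (r : {linear V -> U}) (r' : {linear P -> U}),
  projective P /\ forall x, r (i x) + r' (i' x) = x.

Lemma stable_summandP U V : stable_summand U V <-> stable_retract U V.
Proof.
split=> [[P projP [W /isoP[h [h' [hK h'K]]]]]|[P [i [i' [r [r' [projP rK]]]]]]].
  have [i iE] := linear_inl U W.
  have [j jE] := linear_inl V P.
  have [k kE] := linear_inr V P.
  have [p pE] := linear_fst V P; have [q qE] := linear_snd V P.
  have [u uE] := linear_fst U W.
  exists P, (p \o (h \o i)), (q \o (h \o i)), (u \o (h' \o j)), (u \o (h' \o k)).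
  split=> // x /=; rewrite -linearD -linearD jE kE pE qE iE.
  by rewrite pair_split -surjective_pairing hK uE.
have [e eE] := linear_pair i i'; have [p pE] := linear_copair r r'.
have pe x : p (e x) = x by rewrite pE eE rK.
have [W [k [kinj kP]]] := @kernel_ex (fg_prod V P) U p.
exists P => //; exists W.
have [f fE] := linear_copair e k; apply: (iso_of_bij (f := f)).
  apply: raddf_inj => -[x w] fxw0.
  have fxw : e x + k w = 0 := etrans (esym (fE (x, w))) fxw0.
  have x0 : x = 0.
    have := congr1 p fxw; rewrite linearD pe linear0.
    by rewrite (exact_comp0 _ kP) addr0.
  by move: fxw; rewrite x0 linear0 add0r -(linear0 k) => /kinj ->.
move=> z; have [|w wE] := (kP (z - e (p z))).1; first by rewrite linearB pe subrr.
by exists (p z, w); rewrite fE /= wE addrC subrK.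
Qed.

Lemma stable_retract_retract U V (i : {linear U -> V}) (r : {linear V -> U}) :
  cancel i r -> stable_retract U V.
Proof.
move=> iK; exists fg_zero, i, \0, r, \0; split; first exact: free_projective.
by move=> x; rewrite iK addr0.
Qed.

Lemma stable_retract_iso U V : iso U V -> stable_retract U V.
Proof. by case/isoP=> f [g [fK _]]; apply: stable_retract_retract fK. Qed.

Lemma stable_retract_refl U : stable_retract U U.
Proof. exact/stable_retract_iso/iso_refl. Qed.

Lemma stable_retract_projective P V : projective P -> stable_retract P V.
Proof.
by move=> projP; exists P, \0, idfun, \0, idfun; split=> // x; rewrite add0r.
Qed.

Lemma stable_retract_trans U V W :
  stable_retract U V -> stable_retract V W -> stable_retract U W.
Proof.
case=> [P [i [i' [r [r' [projP rK]]]]]] [Q [j [j' [t [t' [projQ tK]]]]]].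
have [a aE] := linear_pair (j' \o i) i'; have [b bE] := linear_copair (r \o t') r'.
exists (fg_prod Q P), (j \o i), a, (r \o t), b; split; first exact: prod_projective.
by move=> x; rewrite aE bE /= addrA -linearD tK rK.
Qed.

(* Schanuel's lemma *)
Lemma stable_retract_kernel M M' S S' Q Q'
    (i : {linear S -> Q}) (q : {linear Q -> M})
    (i' : {linear S' -> Q'}) (q' : {linear Q' -> M'}) :
  stable_retract M M' -> projective Q -> projective Q' ->
  short_exact i q -> short_exact i' q' -> stable_retract S S'.
Proof.
case=> [P [j1 [j2 [r1 [r2 [projP rK]]]]]] projQ projQ' [iinj iq qs] [i'inj iq' qs'].
have [u uP] := projQ _ _ q' (j1 \o q) qs'.
have [v vP] := projQ' _ _ q (r1 \o q') qs.
have [w wP] := projP _ _ q r2 qs.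
have [|j jP] := exact_lift (h := u \o i) i'inj iq'.
  by move=> x /=; rewrite uP /= (exact_comp0 _ iq) linear0.
have [|t tP] := exact_lift (h := v \o i') iinj iq.
  by move=> x /=; rewrite vP /= (exact_comp0 _ iq') linear0.
have [|d dE] := @linear_ex R Q Q (fun x => x - (v (u x) + w (j2 (q x)))).
  move=> a x y; rewrite !linearP /= scalerBr scalerDr.
  by rewrite [X in _ - X]addrACA opprD addrACA.
have [|k kP] := exact_lift (h := d) iinj iq.
  move=> x; rewrite dE linearB linearD vP wP /= uP /= rK; exact: subrr.
exists Q, j, i, t, k; split=> // x; apply: iinj.
rewrite linearD tP kP dE /= jP /= (exact_comp0 _ iq) !linear0 addr0.
by rewrite addrC subrK.
Qed.

Lemma is_syzygyP M S : is_syzygy M S ->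
  exists P (i : {linear S -> P}) (p : {linear P -> M}),
    projective P /\ short_exact i p.
Proof. by case=> [P [p [i [[projP ps _] iinj ip]]]]; exists P, i, p. Qed.

Lemma is_syzygy_ex M : exists S, is_syzygy M S.
Proof.
have [P [p pcov]] := projective_covers M; have [S [i [iinj ip]]] := kernel_ex p.
by exists S, P, p, i.
Qed.

Lemma is_nsyzygy_ex n M : exists S, is_nsyzygy n M S.
Proof.
elim: n => [|n [T MT]]; first by exists M; apply: iso_refl.
by have [S TS] := is_syzygy_ex T; exists S, T.
Qed.

Lemma is_syzygy_iso M S S' : is_syzygy M S -> iso S S' -> is_syzygy M S'.
Proof.
case=> [P [p [i [pcov iinj ip]]]] /isoP[f [g [fK gK]]].
exists P, p, (i \o g); split=> //; first by apply: inj_comp => //; exact: can_inj gK.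
move=> y; split=> [/ip[x <-]|[x <-]]; first by exists (f x); rewrite /= fK.
by apply/ip; exists (g x).
Qed.

Lemma is_nsyzygyS n M M1 S :
  is_syzygy M M1 -> is_nsyzygy n M1 S -> is_nsyzygy n.+1 M S.
Proof.
move=> MM1; elim: n S => [|n IHn] S /= => [M1S|[T M1T TS]].
  by exists M; [apply: iso_refl | apply: is_syzygy_iso M1S].
by exists T => //; apply: IHn.
Qed.

Lemma stable_retract_syzygy M M' S S' : stable_retract M M' ->
  is_syzygy M S -> is_syzygy M' S' -> stable_retract S S'.
Proof.
move=> MM' /is_syzygyP[P [i [p [projP ip]]]] /is_syzygyP[P' [i' [p' [projP' ip']]]].
exact: (stable_retract_kernel MM' projP projP' ip ip').
Qed.

Lemma stable_retract_nsyzygy n M M' S S' : stable_retract M M' ->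
  is_nsyzygy n M S -> is_nsyzygy n M' S' -> stable_retract S S'.
Proof.
move=> MM'; elim: n S S' => [|n IHn] S S' /=.
  move=> /iso_sym/stable_retract_iso SM /stable_retract_iso MS'.
  exact: stable_retract_trans SM (stable_retract_trans MM' MS').
by move=> [T MT TS] [T' MT' TS']; apply: stable_retract_syzygy TS TS'; apply: IHn.
Qed.

Definition finite_dell k M := enat_finite (dell k M).

Lemma finite_dellP k M : finite_dell k M <-> exists n N S T,
  [/\ is_nsyzygy n M S, is_nsyzygy (n + k) N T & stable_retract S T].
Proof.
split=> [/enat_inf_finite[n [N [S [T [MS NT /stable_summandP ST]]]]]|].
  by exists n, N, S, T.
move=> [n [N [S [T [MS NT ST]]]]]; apply/enat_inf_finite.
by exists n, N, S, T; split=> //; apply/stable_summandP.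
Qed.

Lemma finite_dell_retract k M M' :
  stable_retract M M' -> finite_dell k M' -> finite_dell k M.
Proof.
move=> MM' /finite_dellP[n [N [S [T [M'S NT ST]]]]].
have [S' MS'] := is_nsyzygy_ex n M.
apply/finite_dellP; exists n, N, S', T; split=> //.
exact: stable_retract_trans (stable_retract_nsyzygy MM' MS' M'S) ST.
Qed.

Lemma finite_dell_projective k P : projective P -> finite_dell k P.
Proof.
move=> projP; have [T PT] := is_nsyzygy_ex k P.
apply/finite_dellP; exists 0%N, P, P, T; split=> //; first exact: iso_refl.
exact: stable_retract_projective.
Qed.

Lemma finite_dell_kernel k M S Q (i : {linear S -> Q}) (q : {linear Q -> M}) :
  projective Q -> short_exact i q -> finite_dell k M -> finite_dell k.+1 S.
Proof.
move=> projQ iq /finite_dellP[n [N [U [V [MU NV UV]]]]].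
have [M1 MM1] := is_syzygy_ex M; have [X M1X] := is_nsyzygy_ex n M1.
have [V1 VV1] := is_syzygy_ex V; have [Y SY] := is_nsyzygy_ex n S.
apply/finite_dellP; exists n, N, Y, V1; split=> //.
  by rewrite addnS; exists V.
have SM1 : stable_retract S M1.
  have [P [j [p [projP jp]]]] := is_syzygyP MM1.
  exact: (stable_retract_kernel (stable_retract_refl M) projQ projP iq jp).
apply: stable_retract_trans (stable_retract_nsyzygy SM1 SY M1X) _.
have [U1 UU1] := is_syzygy_ex U.
apply: (@stable_retract_trans _ U1); last exact: stable_retract_syzygy UV UU1 VV1.
apply: (@stable_retract_nsyzygy n.+1 M M); first exact: stable_retract_refl.
  exact: is_nsyzygyS MM1 M1X.
by exists U.
Qed.

Lemma finite_dellW k M : finite_dell k.+1 M -> finite_dell k M.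
Proof.
move=> /finite_dellP[n [N [S [T [MS NT ST]]]]].
have [N1 NN1] := is_syzygy_ex N; have [T1 N1T1] := is_nsyzygy_ex (n + k) N1.
apply/finite_dellP; exists n, N1, S, T1; split=> //.
apply: stable_retract_trans ST _.
rewrite addnS in NT.
exact: stable_retract_nsyzygy (stable_retract_refl N) NT (is_nsyzygyS NN1 N1T1).
Qed.

Lemma kernel_comp A N (X Y Z : fgmod R) (i : {linear N -> X}) (p : {linear X -> Y})
    (j : {linear A -> Y}) (q : {linear Y -> Z}) :
  short_exact i p -> short_exact j q ->
  exists W (k : {linear W -> X}), short_exact k (q \o p) /\ ses N W A.
Proof.
case=> [iinj ip ps] [jinj jq qs].
have [W [k [kinj kqp]]] := kernel_ex (q \o p).
have [|i' i'P] := exact_lift (h := i) kinj kqp.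
  by move=> x; rewrite /= (exact_comp0 _ ip) linear0.
have [|p' p'P] := exact_lift (h := p \o k) jinj jq.
  by move=> x; exact: (exact_comp0 _ kqp).
exists W, k; split.
  by split=> // z; have [y <-] := qs z; have [x <-] := ps y; exists x.
exists i', p'; split.
- by move=> x y /(congr1 k); rewrite !i'P => /iinj.
- move=> w; split=> [pw0|[x <-]].
    have /ip[x xE] : p (k w) = 0 by have := p'P w; rewrite pw0 linear0.
    by exists x; apply: kinj; rewrite i'P.
  by apply: jinj; rewrite p'P /= i'P (exact_comp0 _ ip) linear0.
- move=> a; have [x xE] := ps (j a).
  have [|w wE] := (kqp x).1; first by rewrite /= xE (exact_comp0 _ jq).
  by exists w; apply: jinj; rewrite p'P /= wE.
Qed.

Lemma pullback_ex A B C (A' B' : fgmod R) (f : {linear A -> B}) (g : {linear B -> C})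
    (f' : {linear A' -> B'}) (g' : {linear B' -> C}) :
  short_exact f g -> short_exact f' g' ->
  exists (X : fgmod R) (p : {linear X -> B}) (p' : {linear X -> B'})
    (i : {linear A -> X}) (i' : {linear A' -> X}),
  short_exact i' p /\ short_exact i p'.
Proof.
case=> [finj fg gs] [f'inj f'g' g's].
have [d dE] : exists d : {linear fg_prod B B' -> C}, _ :=
  linear_copair g (g' \o -%R).
have [X [k [kinj kd]]] := kernel_ex d.
have dk x : g (k x).1 = g' (k x).2.
  have := exact_comp0 x kd; rewrite dE /= linearN => /eqP.
  by rewrite subr_eq0 => /eqP.
have kP b b' : g b = g' b' -> exists x, k x = (b, b').
  by move=> gb; apply/kd; rewrite dE /= linearN gb subrr.
have [p pE] : exists p : {linear fg_prod B B' -> B}, _ := linear_fst B B'.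
have [q qE] : exists q : {linear fg_prod B B' -> B'}, _ := linear_snd B B'.
have [u uE] : exists u : {linear B -> fg_prod B B'}, _ := linear_inl B B'.
have [v vE] : exists v : {linear B' -> fg_prod B B'}, _ := linear_inr B B'.
have [|i iP] := exact_lift (h := u \o f) kinj kd.
  by move=> x; rewrite dE /= uE /= oppr0 linear0 addr0 (exact_comp0 _ fg).
have [|i' i'P] := exact_lift (h := v \o f') kinj kd.
  by move=> x; rewrite dE /= vE /= linear0 add0r linearN (exact_comp0 _ f'g') oppr0.
exists X, (p \o k), (q \o k), i, i'; split; split.
- move=> x y /(congr1 k); rewrite !i'P /= !vE => -[] /f'inj //.
- move=> x /=; rewrite pE; split=> [kx0|[a <-]]; last by rewrite i'P /= vE.
  have [|a aE] := (f'g' (k x).2).1; first by rewrite -dk kx0 linear0.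
  by exists a; apply: kinj; rewrite i'P /= vE aE -kx0 -surjective_pairing.
- move=> b; have [b' b'E] := g's (g b); have [x xE] := kP b b' (esym b'E).
  by exists x; rewrite /= pE xE.
- move=> x y /(congr1 k); rewrite !iP /= !uE => -[] /finj //.
- move=> x /=; rewrite qE; split=> [kx0|[a <-]]; last by rewrite iP /= uE.
  have [|a aE] := (fg (k x).1).1; first by rewrite dk kx0 linear0.
  by exists a; apply: kinj; rewrite iP /= uE aE -kx0 -surjective_pairing.
- move=> b'; have [b bE] := gs (g' b'); have [x xE] := kP b b' bE.
  by exists x; rewrite /= qE xE.
Qed.

Lemma split_ex A (X : fgmod R) P (f : {linear A -> X}) (g : {linear X -> P}) :
  projective P -> short_exact f g ->
  exists (sec : {linear P -> X}) (ret : {linear X -> A}),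
    cancel sec g /\ forall x, f (ret x) = x - sec (g x).
Proof.
move=> projP [finj fg gs]; have [t tP] := projP _ _ g idfun gs.
have [|d dE] := @linear_ex R X X (fun x => x - t (g x)).
  by move=> a x y; rewrite !linearP /= scalerBr addrACA scalerN.
have [|r rP] := exact_lift (h := d) finj fg.
  by move=> x; rewrite dE linearB tP subrr.
by exists t, r; split=> // x; rewrite rP dE.
Qed.

Lemma ses_split_swap A (X : fgmod R) P : projective P -> ses A X P -> ses P X A.
Proof.
move=> projP [f [g fgE]]; have [t [r [tK rP]]] := split_ex projP fgE.
have [finj fg gs] := fgE; exists t, r; split; first exact: can_inj tK.
- move=> x; split=> [rx0|[y <-]]; last first.
    by apply: finj; rewrite rP tK subrr linear0.
  exists (g x); apply/esym/eqP; rewrite -subr_eq0 -rP rx0 linear0 //.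
- move=> a; exists (f a); apply: finj.
  by rewrite rP (exact_comp0 _ fg) linear0 subr0.
Qed.

Lemma ses_prod_split A1 A0 A (X : fgmod R) P :
  projective P -> ses A1 A0 A -> ses A X P ->
  exists (i : {linear A1 -> fg_prod A0 P}) (p : {linear fg_prod A0 P -> X}),
    short_exact i p.
Proof.
move=> projP [i [p [iinj ip ps]]] [f [g fgE]].
have [t [r [tK rP]]] := split_ex projP fgE; have [finj fg gs] := fgE.
have [u uE] : exists u : {linear A0 -> fg_prod A0 P}, _ := linear_inl A0 P.
have [h hE] : exists h : {linear fg_prod A0 P -> X}, _ := linear_copair (f \o p) t.
exists (u \o i), h; split.
- by move=> x y; rewrite /= !uE => -[] /iinj.
- move=> z; split=> [hz0|[x <-]]; last first.
    by rewrite /= uE hE /= (exact_comp0 _ ip) !linear0 addr0.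
  have e : f (p z.1) + t z.2 = 0 := etrans (esym (hE z)) hz0.
  have z2 : z.2 = 0.
    by have := congr1 g e; rewrite linearD (exact_comp0 _ fg) tK add0r linear0.
  have [|x xE] := (ip z.1).1.
    by apply: finj; rewrite linear0 -e z2 linear0 addr0.
  by exists x; rewrite /= uE xE -z2 -surjective_pairing.
- move=> x; have [y yE] := ps (r x); exists (y, g x).
  by rewrite hE /= yE rP subrK.
Qed.

Fixpoint resolvable n k M : Prop :=
  if n is n'.+1 then
    exists M1 C0, [/\ ses M1 C0 M, finite_dell k C0 & resolvable n' k.+1 M1]
  else forall x : M, x = 0.

Lemma resolvable_iso n k M M' : iso M M' -> resolvable n k M -> resolvable n k M'.
Proof.
move=> /isoP[f [g [fK gK]]]; case: n => [M0 x|n].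
  by rewrite -(gK x) (M0 (g x)) linear0.
move=> [M1 [C0 [[i [p [iinj ip ps]]] C0k M1k]]]; exists M1, C0; split=> //.
exists i, (f \o p); split=> // [x|y].
  split=> [/= fpx|[z <-]]; last by rewrite /= (exact_comp0 _ ip) linear0.
  by apply/ip; rewrite -(fK (p x)) fpx linear0.
by have [x xE] := ps (g y); exists x; rewrite /= xE.
Qed.

Lemma finite_dell_resolvable k M : finite_dell k M -> resolvable 1 k M.
Proof.
move=> Mk; exists fg_zero, M; split=> //; last exact: fg_zero_eq0.
exists \0, idfun; split=> [x y _|x|x].
- by rewrite (fg_zero_eq0 x) (fg_zero_eq0 y).
- by split=> [/= ->|[y <-]] //; exists 0.
- by exists x.
Qed.

Lemma resolvableW n k M : resolvable n k.+1 M -> resolvable n k M.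
Proof.
elim: n k M => // n IHn k M [M1 [C0 [sM C0k M1k]]]; exists M1, C0.
by split=> //; [apply: finite_dellW | apply: IHn].
Qed.

Lemma ses_iso_r A B C : (forall x : A, x = 0) -> ses A B C -> iso B C.
Proof.
move=> A0 [f [g [finj fg gs]]]; apply: (iso_of_bij (f := g)) => //.
by apply: raddf_inj => x /fg[y <-]; rewrite (A0 y) linear0.
Qed.

Lemma ses_iso_l A B C : (forall x : C, x = 0) -> ses A B C -> iso A B.
Proof.
move=> C0 [f [g [finj fg gs]]]; apply: (iso_of_bij (f := f)) => // y.
by apply/fg; rewrite (C0 (g y)).
Qed.

Lemma finite_dell_prod k M P :
  projective P -> finite_dell k M -> finite_dell k (fg_prod M P).
Proof.
move=> projP; apply: finite_dell_retract.
have [p pE] : exists p : {linear fg_prod M P -> M}, _ := linear_fst M P.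
have [q qE] : exists q : {linear fg_prod M P -> P}, _ := linear_snd M P.
have [u uE] : exists u : {linear M -> fg_prod M P}, _ := linear_inl M P.
have [v vE] : exists v : {linear P -> fg_prod M P}, _ := linear_inr M P.
exists P, p, q, u, v; split=> // x.
by rewrite pE qE uE vE pair_split -surjective_pairing.
Qed.

Lemma resolvable_ext_dell n k A B C :
  ses A B C -> finite_dell k C -> resolvable n k A -> exists m, resolvable m k B.
Proof.
elim: n k A B C => [|n IHn] k A B C sABC Ck /=.
  move=> A0; exists 1%N; apply: finite_dell_resolvable.
  exact: finite_dell_retract (stable_retract_iso (ses_iso_r A0 sABC)) Ck.
move=> [A1 [A0 [sA A0k A1k]]]; have [f [g fg]] := sABC.
have [P [q [projP qs]]] := free_cover C; have [S [i [iinj iq]]] := kernel_ex q.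
have siq : short_exact i q by [].
have [X [p [p' [j [j' [j'p jp']]]]]] := pullback_ex fg siq.
have [|u [v uv]] := ses_prod_split projP sA (X := X); first by exists j, p'.
have [W [w [wE sW]]] := kernel_comp uv j'p.
have [m Wm] := IHn _ _ _ _ sW (finite_dell_kernel projP siq Ck) A1k.
exists m.+1, W, (fg_prod A0 P); split=> //; first by exists w, (p \o v).
exact: finite_dell_prod.
Qed.

Lemma resolvable_coker_of_ext c :
  (forall n k A B C, ses A B C -> resolvable n k A -> resolvable c k C ->
     exists m, resolvable m k B) ->
  forall n k A B C, ses A B C -> resolvable c k.+1 A -> resolvable n k B ->
    exists m, resolvable m k C.
Proof.
move=> ext [|n] k A B C [f [g fg]] Ak /= => [B0|[B1 [B0 [[i [p ip]] B0k B1k]]]].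
  exists 0%N => x; case: fg => _ _ gs; have [y <-] := gs x.
  by rewrite (B0 y) linear0.
have [W [w [wE sW]]] := kernel_comp ip fg.
have [m Wm] := ext _ _ _ _ _ sW B1k Ak.
by exists m.+1, W, B0; split=> //; exists w, (g \o p).
Qed.

Lemma resolvable_ext c n k A B C :
  ses A B C -> resolvable n k A -> resolvable c k C -> exists m, resolvable m k B.
Proof.
elim: c n k A B C => [|c IHc] n k A B C sABC Ak /= => [C0|].
  by exists n; apply: resolvable_iso (ses_iso_l C0 sABC) Ak.
move=> [C1 [C0 [[i [p ip]] C0k C1k]]]; have [f [g fg]] := sABC.
have [X [q [q' [j [j' [j'q jq']]]]]] := pullback_ex fg ip.
have [|m Xm] := resolvable_ext_dell _ C0k Ak (B := X); first by exists j, q'.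
by apply: (resolvable_coker_of_ext IHc _ C1k Xm); exists j', q.
Qed.

Lemma resolvable_coker c n k A B C :
  ses A B C -> resolvable c k.+1 A -> resolvable n k B -> exists m, resolvable m k C.
Proof. by apply: resolvable_coker_of_ext => *; apply: resolvable_ext; eauto. Qed.

Lemma resolvable_ker c n k A B C :
  ses A B C -> resolvable n k.+1 B -> resolvable c k C ->
  exists m, resolvable m k.+1 A.
Proof.
move=> sABC Bk; case: c => [|c] /= => [C0|[C1 [C0 [[i [p ip]] C0k C1k]]]].
  exists n; apply: resolvable_iso Bk; exact/iso_sym/(ses_iso_l C0 sABC).
have [P [q [projP qs]]] := free_cover C0; have [S [j [jinj jq]]] := kernel_ex q.
have sjq : short_exact j q by [].
have [W [w [wE sW]]] := kernel_comp sjq ip.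
have Sk := finite_dell_resolvable (finite_dell_kernel projP sjq C0k).
have [m Wm] := resolvable_ext sW Sk C1k.
have [f [g fg]] := sABC.
have [X [u [u' [v [v' [v'u vu']]]]]] := pullback_ex fg wE.
have [|l Xl] := resolvable_ext (B := X) _ Wm Bk; first by exists v', u.
have Pk := finite_dell_resolvable (finite_dell_projective k.+2 projP).
by apply: (resolvable_coker _ Pk Xl); apply: ses_split_swap => //; exists v, u'.
Qed.

Lemma zero_projective M : (forall x : M, x = 0) -> projective M.
Proof.
by move=> M0 U V g f _; exists \0 => x; rewrite (M0 x) !linear0.
Qed.

Lemma exact_resolution_resolvable n k M (C : nat -> fgmod R)
    (d : forall i, {linear C i.+1 -> C i}) (eps : {linear C 0%N -> M}) :
  exact_resolution n d eps -> (forall i, (i <= n)%N -> finite_dell (i + k) (C i)) ->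
  resolvable n.+1 k M.
Proof.
elim: n k M C d eps => [|n IHn] k M C d eps [epss d0 dS Cn] Ck.
  exists (C 1%N), (C 0%N); split; [|exact: (Ck 0%N)|exact: Cn].
  exists (d 0%N), eps; split=> // x y _.
  by rewrite (Cn 1%N isT x) (Cn 1%N isT y).
have [M1 [i [iinj ieps]]] := kernel_ex eps.
have [|e eP] := exact_lift (h := d 0%N) iinj ieps.
  by move=> x; exact: (exact_comp0 _ d0).
exists M1, (C 0%N); split; [by exists i, eps|exact: (Ck 0%N)|].
apply: (IHn k.+1 M1 (fun j => C j.+1) (fun j => d j.+1) e); last first.
  by move=> j jn; rewrite -addSnnS; exact: Ck.
split=> [y|y|j|j jn].
- have [|x xE] := (d0 (i y)).1; first exact: (exact_comp0 _ ieps).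
  by exists x; apply: iinj; rewrite eP.
- split=> [ey0|[x <-]]; first by apply/dS; rewrite -eP ey0 linear0.
  by apply: iinj; rewrite eP (exact_comp0 _ (dS 0%N)) linear0.
- exact: dS.
- exact: Cn.
Qed.

Lemma resolvable_exact_resolution n k M : resolvable n k M ->
  exists (C : nat -> fgmod R) (d : forall i, {linear C i.+1 -> C i})
    (eps : {linear C 0%N -> M}),
  exact_resolution n d eps /\ forall i, finite_dell (i + k) (C i).
Proof.
elim: n k M => [|n IHn] k M /= => [M0|[M1 [C0 [[f [g [finj fg gs]]] C0k M1k]]]].
  exists (fun=> M), (fun=> \0), \0; split; last first.
    by move=> i; apply/finite_dell_projective/zero_projective.
  split=> [x|x|i x|i _ //]; [exists 0 | split | split];
    by rewrite ?(M0 x) //; exists 0.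
have [C [d [eps [[epss d0 dS Cn] Ck]]]] := IHn _ _ M1k.
pose C' i := if i is j.+1 then C j else C0.
pose d' i : {linear C' i.+1 -> C' i} := if i is j.+1 then d j else f \o eps.
exists C', d', g; split; last by case=> [|i] //; rewrite addSnnS; exact: Ck.
split=> //.
- move=> x; split=> [/fg[y <-]|[y <-]]; last exact: (exact_comp0 _ fg).
  by have [z <-] := epss y; exists z.
- case=> [|i]; last exact: dS.
  move=> x; split=> [/= fex|[y <-]].
    by apply/d0; apply: finj; rewrite fex linear0.
  by rewrite /= (exact_comp0 _ d0) linear0.
- by case=> // i; exact: Cn.
Qed.

Lemma finite_ddellP k M :
  enat_finite (ddell k M) <-> exists n, resolvable n k M.
Proof.
split=> [/enat_inf_finite[m [n [C [d [eps [nm res Ck]]]]]]|[n]].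
  exists n.+1; apply: (exact_resolution_resolvable res) => i ilen.
  by move: (Ck i ilen); rewrite /finite_dell; case: (dell _ _).
move=> /resolvable_exact_resolution[C [d [eps [res Ck]]]].
pose b i := odflt 0%N (dell (i + k) (C i)).
pose m := (n + \max_(i < n.+1) b i)%N.
apply/enat_inf_finite; exists m, n, C, d, eps; split=> // [|i ilen].
  exact: leq_addr.
have : (b i <= \max_(i < n.+1) b i)%N.
  by rewrite (leq_bigmax (Ordinal (ilen : (i < n.+1)%N))).
move: (Ck i); rewrite /b /finite_dell; case: (dell _ _) => //= e _ le_e.
by rewrite leq_subRL ?(leq_trans ilen (leq_addr _ _)) // leq_add.
Qed.

Definition totally_resolvable M :=
  forall k, (1 <= k)%N -> enat_finite (ddell k M).

Lemma totally_resolvable_2_of_3 A B C : ses A B C ->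
  [/\ totally_resolvable A -> totally_resolvable B -> totally_resolvable C,
      totally_resolvable A -> totally_resolvable C -> totally_resolvable B
    & totally_resolvable B -> totally_resolvable C -> totally_resolvable A].
Proof.
move=> sABC; split=> HX HY k k1; apply/finite_ddellP.
- have /finite_ddellP[a Ak] := HX k.+1 isT; have /finite_ddellP[b Bk] := HY k k1.
  exact: resolvable_coker sABC Ak Bk.
- have /finite_ddellP[a Ak] := HX k k1; have /finite_ddellP[c Ck] := HY k k1.
  exact: resolvable_ext sABC Ak Ck.
- have /finite_ddellP[b Bk] := HX k.+1 isT; have /finite_ddellP[c Ck] := HY k k1.
  have [m Am] := resolvable_ker sABC Bk Ck.
  by exists m; apply: resolvableW.
Qed.

Lemma totally_resolvable_iso M M' :
  iso M M' -> totally_resolvable M -> totally_resolvable M'.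
Proof.
move=> MM' HM k k1; have /finite_ddellP[n Mk] := HM k k1.
by apply/finite_ddellP; exists n; apply: resolvable_iso Mk.
Qed.

End Syzygies.

Section RightDual.
Variables (K : fieldType) (L : falgType K).

Definition in_opp_alg (c : K) : L^c := (c%:A : L).

Lemma in_opp_alg_additive : additive in_opp_alg.
Proof. by move=> a b; rewrite /in_opp_alg scalerBl. Qed.

Lemma in_opp_alg_monoid : monoid_morphism in_opp_alg.
Proof.
split=> [|a b]; first exact: scale1r.
by rewrite /in_opp_alg mulrC -scalerA -[in LHS]mulr_algl.
Qed.

HB.instance Definition _ :=
  GRing.isZmodMorphism.Build K L^c in_opp_alg in_opp_alg_additive.
HB.instance Definition _ :=
  GRing.isMonoidMorphism.Build K L^c in_opp_alg in_opp_alg_monoid.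

Lemma falg_finite : exists n (b : 'I_n -> L),
  forall a, exists c : 'I_n -> K, a = \sum_i in_alg L (c i) * b i.
Proof.
exists (\dim {:L}), (fun i => (vbasis {:L})`_i) => a.
exists (fun i => coord (vbasis {:L}) i a).
rewrite {1}(coord_vbasis (memvf a)); apply: eq_bigr => i _.
by rewrite /= mulr_algl.
Qed.

Lemma opp_falg_finite : exists n (b : 'I_n -> L^c),
  forall a, exists c : 'I_n -> K, a = \sum_i in_opp_alg (c i) * b i.
Proof.
have [n [b bP]] := falg_finite; exists n, b => a; have [c aE] := bP a.
exists c; rewrite [LHS]aE; apply: eq_bigr => i _.
by rewrite /= mulr_algl -mulr_algr.
Qed.

Section RightDualModule.
Variable X : lmodType L^c.

Definition opp_Klinear (f : X -> K) : Prop :=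
  forall (c : K) (x y : X), f (in_opp_alg c *: x + y) = c * f x + f y.

(* Hom_K(X, K) for a right L-module X: it is a left L-module, whereas [Kdual]
   turns left modules into right ones. *)
Record rdual : Type := RDual {
  rdual_fun :> X -> K;
  rdual_funP : `[< opp_Klinear rdual_fun >]
}.
Implicit Types f g h : rdual.

HB.instance Definition _ := [isSub for rdual_fun].
HB.instance Definition _ := [Choice of rdual by <:].

Lemma rdualP f g : (forall x, f x = g x) -> f = g.
Proof. by move=> fg; apply/val_inj/funext. Qed.

Lemma rdual_linear f : opp_Klinear f.
Proof. exact: asboolW (rdual_funP f). Qed.

Lemma rdual0_subproof : `[< opp_Klinear (fun=> 0) >].
Proof. by apply/asboolP=> c x y; rewrite mulr0 addr0. Qed.

Lemma rdualN_subproof f : `[< opp_Klinear (fun x => - f x) >].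
Proof. by apply/asboolP=> c x y; rewrite rdual_linear opprD mulrN. Qed.

Lemma rdualD_subproof f g : `[< opp_Klinear (fun x => f x + g x) >].
Proof. by apply/asboolP=> c x y; rewrite !rdual_linear mulrDr addrACA. Qed.

Lemma rdualZ_subproof (a : L) f : `[< opp_Klinear (fun x => f ((a : L^c) *: x)) >].
Proof.
apply/asboolP=> c x y; rewrite -rdual_linear scalerDr !scalerA.
by congr (f (_ *: x + _)); apply: etrans (mulr_algl c a) (esym (mulr_algr c a)).
Qed.

Definition rdual0 := RDual rdual0_subproof.
Definition rdualN f := RDual (rdualN_subproof f).
Definition rdualD f g := RDual (rdualD_subproof f g).
Definition rdualZ (a : L) f := RDual (rdualZ_subproof a f).

Lemma rdualDA : associative rdualD.
Proof. by move=> f g h; apply/rdualP=> x /=; rewrite addrA. Qed.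

Lemma rdualDC : commutative rdualD.
Proof. by move=> f g; apply/rdualP=> x /=; rewrite addrC. Qed.

Lemma rdual0D : left_id rdual0 rdualD.
Proof. by move=> f; apply/rdualP=> x /=; rewrite add0r. Qed.

Lemma rdualND : left_inverse rdual0 rdualN rdualD.
Proof. by move=> f; apply/rdualP=> x /=; rewrite addNr. Qed.

HB.instance Definition _ :=
  GRing.isZmodule.Build rdual rdualDA rdualDC rdual0D rdualND.

Lemma rdualZA (a b : L) f : rdualZ a (rdualZ b f) = rdualZ (a * b) f.
Proof. by apply/rdualP=> x /=; rewrite scalerA. Qed.

Lemma rdual1Z : left_id 1 rdualZ.
Proof. by move=> f; apply/rdualP=> x /=; rewrite scale1r. Qed.

Lemma rdualZDr : right_distributive rdualZ +%R.
Proof. by move=> a f g; apply/rdualP. Qed.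

Lemma rdual_add f x y : f (x + y) = f x + f y.
Proof.
by have := rdual_linear f 1 x y; rewrite (rmorph1 in_opp_alg) scale1r mul1r.
Qed.

Lemma rdualZDl f : {morph rdualZ^~ f : a b / a + b}.
Proof.
by move=> a b; apply/rdualP=> x /=; rewrite -rdual_add -scalerDl.
Qed.

HB.instance Definition _ :=
  GRing.Zmodule_isLmodule.Build L rdual rdualZA rdual1Z rdualZDr rdualZDl.

Lemma rdual_sum n (f : 'I_n -> rdual) x : (\sum_i f i) x = \sum_i f i x.
Proof. by elim/big_rec2: _ => // i y g _ <-. Qed.

Lemma rdual_eq0 f : f 0 = 0.
Proof.
by apply: (addIr (f 0)); rewrite -rdual_add !add0r.
Qed.

Lemma rdual_comb f n (c : 'I_n -> K) (e : 'I_n -> X) :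
  f (\sum_i in_opp_alg (c i) *: e i) = \sum_i c i * f (e i).
Proof.
elim/big_rec2: _ => [|i y z _ <-]; first exact: rdual_eq0.
exact: rdual_linear.
Qed.

Lemma rdual_scal f c x : f (in_opp_alg c *: x) = c * f x.
Proof. by rewrite -[in LHS](addr0 (_ *: x)) rdual_linear rdual_eq0 addr0. Qed.

Lemma rdual_frame : finitely_generated X ->
  exists n (e : 'I_n -> X) (d : 'I_n -> rdual),
    forall x, x = \sum_i in_opp_alg (d i x) *: e i.
Proof.
move=> fgX.
have [n [e [d [dlin _ dP]]]] :=
  fg_frame_mod opp_falg_finite fgX (subspace_eq0 in_opp_alg X).
exists n, e, (fun i => RDual (introT (asboolP _) (dlin i : opp_Klinear (d i)))) => x.
by apply/eqP; rewrite -subr_eq0; apply/eqP/dP.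
Qed.

Lemma rdual_expand n (e : 'I_n -> X) (d : 'I_n -> rdual) (f : rdual) :
  (forall x, x = \sum_i in_opp_alg (d i x) *: e i) ->
  f = \sum_i (f (e i))%:A *: d i.
Proof.
move=> eP; apply: rdualP => x; rewrite rdual_sum {1}(eP x) rdual_comb.
by apply: eq_bigr => i _; rewrite mulrC -rdual_scal.
Qed.

Lemma rdual_fg : finitely_generated X -> finitely_generated rdual.
Proof.
move=> /rdual_frame[n [e [d eP]]]; exists n, d => f.
by exists (fun i => (f (e i))%:A); apply: rdual_expand.
Qed.

End RightDualModule.

End RightDual.

Section Bidual.
Variables (K : fieldType) (L : falgType K).

Lemma dual_eq0 (M : lmodType L) (f : Kdual M) : f 0 = 0.
Proof. by have := dual_Klinear f (-1) 0 0; rewrite scaler0 addr0 mulN1r addNr. Qed.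

Lemma dual_add (M : lmodType L) (f : Kdual M) x y : f (x + y) = f x + f y.
Proof. by have := dual_Klinear f 1 x y; rewrite scale1r scale1r mul1r. Qed.

Lemma dual_scal (M : lmodType L) (f : Kdual M) (c : K) x : f (c%:A *: x) = c * f x.
Proof. by rewrite -[in LHS](addr0 (_ *: x)) dual_Klinear dual_eq0 addr0. Qed.

Lemma dual_comb (M : lmodType L) (f : Kdual M) n (c : 'I_n -> K) (e : 'I_n -> M) :
  f (\sum_i (c i)%:A *: e i) = \sum_i c i * f (e i).
Proof.
elim/big_rec2: _ => [|i y z _ <-]; [exact: dual_eq0 | exact: dual_Klinear].
Qed.

Lemma dual_sum (M : lmodType L) n (f : 'I_n -> Kdual M) x :
  (\sum_i f i) x = \sum_i f i x.
Proof. by elim/big_rec2: _ => // i y g _ <-. Qed.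

Lemma dual_frame (M : lmodType L) : finitely_generated M ->
  exists n (e : 'I_n -> M) (d : 'I_n -> Kdual M),
    forall x, x = \sum_i (d i x)%:A *: e i.
Proof.
move=> fgM.
have [n [e [d [dlin _ dP]]]] :=
  fg_frame_mod (falg_finite L) fgM (subspace_eq0 (in_alg L) M).
exists n, e, (fun i => Dual (introT (asboolP _) (dlin i : Klinear (d i)))) => x.
by apply/eqP; rewrite -subr_eq0; apply/eqP/dP.
Qed.

Lemma rdual_transpose (X Y : lmodType L^c) (h : {linear X -> Y}) :
  exists t : {linear rdual Y -> rdual X}, forall (f : rdual Y) x, t f x = f (h x).
Proof.
have lin (f : rdual Y) : `[< opp_Klinear (fun x => f (h x)) >].
  by apply/asboolP=> c x y; rewrite linearP rdual_linear.
have [|t tE] := @linear_ex L (rdual Y) (rdual X) (fun f => RDual (lin f)).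
  by move=> a f g; apply: rdualP => x /=; rewrite linearZ.
by exists t => f x; rewrite tE.
Qed.

Lemma rdual_short_exact (A B C : lmodType L^c)
    (f : {linear A -> B}) (g : {linear B -> C}) :
  finitely_generated B -> short_exact f g ->
  exists (tg : {linear rdual C -> rdual B}) (tf : {linear rdual B -> rdual A}),
    short_exact tg tf.
Proof.
move=> fgB [finj fg gs].
have [tg tgE] := rdual_transpose g; have [tf tfE] := rdual_transpose f.
exists tg, tf; split.
- move=> u v uv; apply: rdualP => y; have [x <-] := gs y.
  by rewrite -!tgE uv.
- move=> u; split=> [tfu0|[v <-]]; last first.
    apply: rdualP => x; rewrite tfE tgE.
    by rewrite (_ : g (f x) = 0) ?rdual_eq0 //; apply/fg; exists x.
  have [r rK] := choice gs.
  have ur x y : g x = g y -> u x = u y.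
    move=> gxy; have [|a aE] := (fg (x - y)).1; first by rewrite linearB gxy subrr.
    by rewrite -(subrK y x) rdual_add -aE -tfE tfu0 add0r.
  have vlin : `[< opp_Klinear (fun y => u (r y)) >].
    apply/asboolP=> c x y; rewrite -rdual_linear; apply: ur.
    by rewrite linearP !rK.
  exists (RDual vlin); apply: rdualP => x; rewrite tgE /=.
  exact/ur/rK.
- move=> u; have [r [rlin rK]] := fg_retraction (opp_falg_finite L) fgB finj.
  have vlin : `[< opp_Klinear (fun y => u (r y)) >].
    by apply/asboolP=> c x y; rewrite rlin rdual_linear.
  by exists (RDual vlin); apply: rdualP => x; rewrite tfE /= rK.
Qed.

Lemma iso_dual_rdual (X : lmodType L^c) :
  finitely_generated X -> iso X (Kdual (rdual X)).
Proof.
move=> /rdual_frame[n [e [d eP]]].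
have evlin x : `[< Klinear (fun f : rdual X => f x) >].
  by apply/asboolP=> c f g /=; rewrite -rdual_scal.
have [|ev evE] := @linear_ex L^c X (Kdual (rdual X)) (fun x => Dual (evlin x)).
  by move=> a x y; apply/dualP => f /=; rewrite rdual_add.
apply: (iso_of_bij (f := ev)) => [x y exy|F].
  have fxy (f : rdual X) : f x = f y.
    by have := congr1 (fun F : Kdual (rdual X) => F f) exy; rewrite !evE.
  by rewrite (eP x) (eP y); apply: eq_bigr => i _; rewrite fxy.
exists (\sum_i in_opp_alg L (F (d i)) *: e i); apply/dualP => f; rewrite evE /=.
rewrite rdual_comb [in RHS](rdual_expand f eP) dual_comb.
by apply: eq_bigr => i _; rewrite mulrC.
Qed.

Lemma iso_rdual_of_iso_dual (X : lmodType L^c) (M : lmodType L) :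
  finitely_generated M -> iso X (Kdual M) -> iso (rdual X) M.
Proof.
move=> /dual_frame[n [e [d eP]]] /isoP[h [h' [hK h'K]]]; apply: iso_sym.
have evlin m : `[< opp_Klinear (fun x => h x m) >].
  by apply/asboolP=> c x y; rewrite linearP -(dual_scal (h x) c m).
have [|ev evE] := @linear_ex L M (rdual X) (fun m => RDual (evlin m)).
  move=> a m p; apply: rdualP => x /=; rewrite dual_add; congr (_ + _).
  by rewrite linearZ.
apply: (iso_of_bij (f := ev)) => [m p emp|F].
  have fmp (f : Kdual M) : f m = f p.
    by have := congr1 (fun F : rdual X => F (h' f)) emp; rewrite !evE /= h'K.
  by rewrite (eP m) (eP p); apply: eq_bigr => i _; rewrite fmp.
exists (\sum_i (F (h' (d i)))%:A *: e i); apply: rdualP => x; rewrite evE /=.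
rewrite dual_comb.
have xE : x = \sum_i in_opp_alg L (h x (e i)) *: h' (d i).
  apply: (can_inj hK); rewrite linear_comb; apply/dualP => m.
  rewrite dual_sum {1}(eP m) dual_comb; apply: eq_bigr => i _.
  by rewrite h'K mulrC -dual_scal.
rewrite [in RHS]xE rdual_comb.
by apply: eq_bigr => i _; rewrite mulrC.
Qed.

End Bidual.

Section Finfty.
Variables (K : fieldType) (L : falgType K).

Lemma falg_submodule_fg (M N : lmodType L) (i : {linear N -> M}) :
  injective i -> finitely_generated M -> finitely_generated N.
Proof. exact: (sub_fg (falg_finite L)). Qed.

Definition fg_rdual (X : fgmod L^c) : fgmod L := Fgmod (rdual_fg (fgmod_fg X)).

Lemma in_FinftyP (X : fgmod L^c) :
  in_Finfty X <-> totally_resolvable (fg_rdual X).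
Proof.
split=> [[M HM XM]|HX]; last first.
  by exists (fg_rdual X) => //; apply/iso_dual_rdual/fgmod_fg.
apply: (totally_resolvable_iso falg_submodule_fg
          (projective_cover_ex (falg_finite L)) _ HM).
exact/iso_sym/iso_rdual_of_iso_dual/XM/fgmod_fg.
Qed.

End Finfty.

Theorem lemma5p6 (K : fieldType) (L : falgType K) (A B C : fgmod L^c)
    (f : {linear A -> B}) (g : {linear B -> C}) :
  short_exact f g ->
  [/\ in_Finfty A -> in_Finfty B -> in_Finfty C,
      in_Finfty A -> in_Finfty C -> in_Finfty B
    & in_Finfty B -> in_Finfty C -> in_Finfty A].
Proof.
move=> fg; have [tg [tf tgf]] := rdual_short_exact (fgmod_fg B) fg.
have sCBA : ses (fg_rdual C) (fg_rdual B) (fg_rdual A) by exists tg, tf.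
have [HCB HCA HBA] := totally_resolvable_2_of_3 (@falg_submodule_fg K L)
  (projective_cover_ex (falg_finite L)) sCBA.
split=> /in_FinftyP HX /in_FinftyP HY; apply/in_FinftyP; auto.
Qed.
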